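(* Let $L$ be a lower bound on the minimum number of relocations of a block relocation problem (BRP) instance. Then Problem 2 is a relaxation of the BRP: every feasible solution of the BRP is a feasible solution of Problem 2, and its objective value with respect to Problem 2 is less than or equal to its objective value with respect to the BRP.
   Context: Setting (BRP). There are $S$ stacks and $B$ blocks labelled $1,\dots,B$; a smaller label means a higher priority. A configuration places blocks in the stacks, each stack being a finite vertical sequence of blocks; the initial configuration $\mathbb{C}$ contains every block exactly once. Stacks have a height limit $H$ (at most $H$ blocks per stack). A relocation takes the topmost block of a stack and puts it on top of a different stack (respecting the height limit). A retrieval removes the block of smallest label among those still present, and is allowed only if it is topmost in its stack. No block is directly retrievable in $\mathbb{C}$ (block $1$ is not topmost). BRP: the feasible solutions are the finite sequences of moves (relocations and retrievals) starting from $\mathbb{C}$ that retrieve all blocks; the objective value, to be minimized, is the number of relocations in the sequence. A direct blockage in a configuration is a pair of blocks such that one lies directly on top of the other in the same stack and the upper one has lower priority (larger label). Problem 2 (with parameter $L$): determine a sequence of moves, starting from $\mathbb{C}$, that retrieves all blocks (and contains at least $L$ relocations), so that after its first $L$ relocations and all applicable retrieval moves (those carried out before the next relocation), the sum of $L$ and the number of direct blockages in the resulting configuration is minimized. This sum is the objective value of Problem 2. *)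

(* Defs.v *)
From mathcomp Require Import all_boot.

Set Implicit Arguments.
Unset Strict Implicit.
Unset Printing Implicit Defensive.

Record min_problem (X : Type) : Type := MinProblem {
  feasible : pred X;
  objective : X -> nat
}.

(* An infeasible problem has no minimum. *)
Definition is_minimum (X : Type) (P : min_problem X) (m : nat) : Prop :=
  (exists2 x, feasible P x & objective P x = m) /\
  (forall x, feasible P x -> m <= objective P x).

(* For an infeasible problem, whose minimum is conventionally +oo, every L
   qualifies. *)
Definition lower_bound_on_minimum (X : Type) (P : min_problem X) (L : nat) :
    Prop :=
  forall m, is_minimum P m -> L <= m.

Definition is_relaxation (X : Type) (Q P : min_problem X) : Prop :=
  forall x, feasible P x -> feasible Q x /\ objective Q x <= objective P x.

(* Blocks are identified with their labels; the smaller the label, the higher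
   the priority. A stack is listed from top to bottom: its head is the topmost
   block. *)
Definition config (S : nat) : Type := {ffun 'I_S -> seq nat}.

Definition blocks (S : nat) (c : config S) : seq nat :=
  flatten [seq c s | s <- enum 'I_S].

Definition initial_config (S B H : nat) (c : config S) : bool :=
  perm_eq (blocks c) (iota 1 B) && [forall s, size (c s) <= H].

(* [Relocate s t] moves the topmost block of [s] onto [t]; [Retrieve s] removes
   the topmost block of [s]. *)
Inductive move (S : nat) : Type :=
| Relocate of 'I_S & 'I_S
| Retrieve of 'I_S.

Definition is_relocation (S : nat) (m : move S) : bool :=
  if m is Relocate _ _ then true else false.

Definition retrievable (S : nat) (c : config S) (s : 'I_S) : bool :=
  if c s is b :: _ then all (leq b) (blocks c) else false.

Definition legal_move (S H : nat) (c : config S) (m : move S) : bool :=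
  match m with
  | Relocate s t => [&& c s != [::], s != t & size (c t) < H]
  | Retrieve s => retrievable c s
  end.

(* Total; meaningful only on legal moves. *)
Definition apply_move (S : nat) (c : config S) (m : move S) : config S :=
  match m with
  | Relocate s t =>
      [ffun x => if x == s then behead (c s)
                 else if x == t then take 1 (c s) ++ c t
                 else c x]
  | Retrieve s => [ffun x => if x == s then behead (c s) else c x]
  end.

Fixpoint legal_moves (S H : nat) (c : config S) (ms : seq (move S)) : bool :=
  if ms is m :: ms' then legal_move H c m && legal_moves H (apply_move c m) ms'
  else true.

Definition run (S : nat) (c : config S) (ms : seq (move S)) : config S :=
  foldl (@apply_move S) c ms.

Definition num_relocations (S : nat) (ms : seq (move S)) : nat :=
  count (@is_relocation S) ms.

Definition retrieves_all (S H : nat) (c : config S) (ms : seq (move S)) :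
    bool :=
  legal_moves H c ms && nilp (blocks (run c ms)).

Definition BRP (S H : nat) (c : config S) : min_problem (seq (move S)) :=
  MinProblem (retrieves_all H c) (@num_relocations S).

(* In [zip st (behead st)] each pair is (upper block, block directly below). *)
Definition direct_blockages (S : nat) (c : config S) : nat :=
  \sum_(s < S) count (fun p => p.2 < p.1) (zip (c s) (behead (c s))).

(* The longest prefix of [ms] with at most [L] relocations: the moves up to the
   [L]-th relocation, together with the retrievals that [ms] carries out before
   the next relocation. *)
Fixpoint first_relocations (S L : nat) (ms : seq (move S)) : seq (move S) :=
  if ms is m :: ms' then
    if is_relocation m then
      if L is L'.+1 then m :: first_relocations L' ms' else [::]
    else m :: first_relocations L ms'
  else [::].

Definition Problem2 (S H L : nat) (c : config S) :
    min_problem (seq (move S)) :=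
  MinProblem
    (fun ms => retrieves_all H c ms && (L <= num_relocations ms))
    (fun ms => L + direct_blockages (run c (first_relocations L ms))).

(* Main.v *)
(** A relocation removes at most one direct blockage and a retrieval removes
    none, since the retrieved block has the smallest remaining label. As the
    final configuration is empty, the number of direct blockages of any
    configuration is a lower bound on the number of relocations still to come;
    apply this after the first [L] relocations. *)
Require Import Defs.
From mathcomp Require Import all_boot.

Set Implicit Arguments.
Unset Strict Implicit.
Unset Printing Implicit Defensive.

Lemma lower_bound_on_minimumP (X : Type) (P : min_problem X) (L : nat) (x : X) :
  lower_bound_on_minimum P L -> feasible P x -> L <= objective P x.
Proof.
move=> hL; have [n] := ubnP (objective P x).
elim: n x => // n IHn x; rewrite ltnS => le_xn fx.
(* If [x] were below [L], the induction hypothesis would make it optimal. *)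
case: (leqP L (objective P x)) => // lt_xL.
suff: L <= objective P x by rewrite leqNgt lt_xL.
apply: hL; split=> [|y fy]; first by exists x.
case: leqP => // lt_yx; have := IHn y (leq_trans lt_yx le_xn) fy.
by rewrite leqNgt (ltn_trans lt_yx lt_xL).
Qed.

Definition stack_blockages (st : seq nat) : nat :=
  count (fun p => p.2 < p.1) (zip st (behead st)).

Lemma stack_blockages_cons b st :
  stack_blockages (b :: st) =
  (if st is b' :: _ then b' < b : nat else 0) + stack_blockages st.
Proof. by case: st. Qed.

Lemma stack_blockages_behead st :
  stack_blockages st <= (stack_blockages (behead st)).+1.
Proof.
case: st => [|b st] //=; rewrite stack_blockages_cons -add1n leq_add2r.
by case: st => [|b' st] //; apply: leq_b1.
Qed.

Lemma stack_blockages_behead_min b st :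
  all (leq b) st -> stack_blockages (b :: st) = stack_blockages st.
Proof.
rewrite stack_blockages_cons; case: st => [|b' st] //= /andP[].
by rewrite leqNgt => /negbTE ->.
Qed.

Lemma stack_blockages_push st st' :
  stack_blockages st <= stack_blockages (take 1 st' ++ st).
Proof.
case: st' => [|b st'] //=.
by rewrite take0 /= stack_blockages_cons leq_addl.
Qed.

Section Moves.

Variables (S H : nat).
Implicit Types (c : config S) (m : move S) (ms : seq (move S)).

Lemma all_blocks (a : pred nat) c s : all a (blocks c) -> all a (c s).
Proof.
move=> /allP ac; apply/allP => b b_cs; apply: ac.
by apply/flattenP; exists (c s) => //; apply: map_f; rewrite mem_enum.
Qed.

Lemma direct_blockages_empty c : nilp (blocks c) -> direct_blockages c = 0.
Proof.
move=> c0; apply: big1 => s _.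
have /(all_blocks s): all pred0 (blocks c) by rewrite (nilP c0).
by case: (c s).
Qed.

Lemma direct_blockages_apply_move c m : legal_move H c m ->
  direct_blockages c <= is_relocation m + direct_blockages (apply_move c m).
Proof.
case: m => [s t | s] /= legal; last first.
  apply: leq_sum => x _; rewrite ffunE; case: eqP => // ->.
  move: legal; rewrite /retrievable.
  case Ecs: (c s) => [|b st] // /(all_blocks s).
  by rewrite Ecs /= => /andP[_ /stack_blockages_behead_min /eq_leq].
have sum1 : \sum_(x < S) (x == s : nat) = 1.
  by rewrite (bigD1 s) //= eqxx big1 // => x /negbTE ->.
rewrite -[X in X + _]sum1 -big_split; apply: leq_sum => x _ /=; rewrite ffunE.
case: (x =P s) => [->|_]; first exact: stack_blockages_behead.
by case: (x =P t) => [->|_] //; apply: stack_blockages_push.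
Qed.

Lemma retrieves_all_cons c m ms :
  retrieves_all H c (m :: ms) =
  legal_move H c m && retrieves_all H (apply_move c m) ms.
Proof. by rewrite /retrieves_all /= andbA. Qed.

Lemma direct_blockages_le_relocations c ms :
  retrieves_all H c ms -> direct_blockages c <= num_relocations ms.
Proof.
elim: ms c => [|m ms IHms] c; first by move/direct_blockages_empty->.
rewrite retrieves_all_cons => /andP[legal /IHms le_ms].
apply: leq_trans (direct_blockages_apply_move legal) _.
by rewrite leq_add2l.
Qed.

Lemma objective_le_relocations L c ms :
  retrieves_all H c ms -> L <= num_relocations ms ->
  L + direct_blockages (run c (first_relocations L ms)) <= num_relocations ms.
Proof.
elim: ms L c => [|m ms IHms] L c sol.
  by rewrite leqn0 => /eqP->; apply: direct_blockages_le_relocations sol.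
have := sol; rewrite retrieves_all_cons => /andP[_ sol'].
case: m sol sol' => [s t|s] sol sol'; last exact: IHms.
case: L => [|L] leL; first exact: direct_blockages_le_relocations sol.
exact: IHms sol' leL.
Qed.

End Moves.

Theorem theorem7 (S B H L : nat) (C : config S)
    (hC : initial_config B H C)
    (hblocked : forall s : 'I_S, ~~ retrievable C s)
    (hL : lower_bound_on_minimum (BRP H C) L) :
  is_relaxation (Problem2 H L C) (BRP H C).
Proof.
move=> ms sol; have leL := lower_bound_on_minimumP hL sol.
split; last exact: objective_le_relocations sol leL.
by apply/andP; split.
Qed.
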